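(* Let $n\ge1$. For each $j$, $1\le j\le n$, let $\{\lambda_N^j,\,N\ge1\}$ be a sequence of probability measures on $\mathbb{R}$ satisfying the large deviation principle with a good, strictly quasi-convex rate function $\mathcal{I}_j$. For each $N\ge1$ let $k(1,N),\dots,k(n,N)\ge0$ be integers with $\sum_{j=1}^nk(j,N)=N$, and write $\sigma\in\{+1,-1\}^N$ as $\sigma=\sigma_1\sigma_2\cdots\sigma_n$ with $\sigma_i\in\{+1,-1\}^{k(i,N)}$. For each $N$ let $\xi(\sigma_1\cdots\sigma_i)$, for $1\le i\le n$ and $\sigma_j\in\{+1,-1\}^{k(j,N)}$ $(1\le j\le i)$, be independent random variables such that $\xi(\sigma_1\cdots\sigma_i)$ has law $\lambda_N^i$ (all $N$ on one probability space). Define the random empirical measure on $\mathbb{R}^n$ $$\mu_N(\omega)=\frac1{2^N}\sum_{\sigma\in\{+1,-1\}^N}\delta_{\left(\xi(\sigma_1,\omega),\,\xi(\sigma_1\sigma_2,\omega),\,\dots,\,\xi(\sigma_1\cdots\sigma_n,\omega)\right)}.$$ Suppose $\frac{k(j,N)}N\to p_j>0$ as $N\to\infty$ for $1\le j\le n$. Then for almost every $\omega$ the sequence $\{\mu_N(\omega),N\ge1\}$ satisfies the large deviation principle with rate function $\mathcal{J}$ given by $$\mathcal{J}(x_1,\dots,x_n)=\begin{cases}\sum_{k=1}^n\mathcal{I}_k(x_k)&\text{if }(x_1,\dots,x_n)\in D,\\ \infty&\text{otherwise,}\end{cases}$$ where $D=\Big\{(x_1,\dots,x_n)\in\mathbb{R}^n:\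 \sum_{k=1}^j\mathcal{I}_k(x_k)\le\sum_{k=1}^jp_k\log2\ \text{ for }1\le j\le n\Big\}$.
   Context: A sequence $\{\mu_N\}$ of probability measures on a Polish space $\mathbb{X}$ satisfies the large deviation principle (LDP) with rate function $\mathcal{I}$ if $\mathcal{I}:\mathbb{X}\to[0,\infty]$ is lower semicontinuous and for every Borel set $B$, $-\inf_{x\in B^0}\mathcal{I}(x)\le\liminf_N\frac1N\log\mu_N(B)\le\limsup_N\frac1N\log\mu_N(B)\le-\inf_{x\in\overline{B}}\mathcal{I}(x)$. The rate function is good if $\{\mathcal{I}\le a\}$ is compact for all $0\le a<\infty$. A function $f$ with values in $(-\infty,+\infty]$ on a convex set is strictly quasi-convex if for any two distinct $x_1,x_2\in\{f<\infty\}$ and each $\theta\in(0,1)$, $f(\theta x_1+(1-\theta)x_2)<\max\{f(x_1),f(x_2)\}$. *)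

(* Defs.v *)
From HB Require Import structures.
From mathcomp Require Import all_boot all_order all_algebra.
From mathcomp Require Import all_classical all_reals all_analysis.

Set Implicit Arguments.
Unset Strict Implicit.
Unset Printing Implicit Defensive.
Import Order.TTheory GRing.Theory Num.Theory.
Import numFieldNormedType.Exports.

Local Open Scope classical_set_scope.
Local Open Scope ring_scope.
Local Open Scope ereal_scope.

(* Large deviation principle for [mu N], [N >= 1], at speed [N].  Only the
   values of [mu N] on the Borel sets [<<s open >>] matter, so that [mu] may be
   a sequence of probability measures on any presentation of the Borel
   sigma-algebra of [X].  Here [lne 0 = -oo] and [ereal_inf set0 = +oo]; the
   term [N = 0] is irrelevant to the limits. *)
Definition LDP (R : realType) (X : topologicalType)
    (mu : nat -> set X -> \bar R) (I : X -> \bar R) : Prop :=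
  [/\ forall x, 0 <= I x,
      lower_semicontinuous I &
      forall B : set X, (<<s [set U : set X | open U] >>) B ->
        [/\ - ereal_inf (I @` B°)
              <= limn_einf (fun N : nat => (N%:R^-1)%:E * lne (mu N B)),
            limn_einf (fun N : nat => (N%:R^-1)%:E * lne (mu N B))
              <= limn_esup (fun N : nat => (N%:R^-1)%:E * lne (mu N B)) &
            limn_esup (fun N : nat => (N%:R^-1)%:E * lne (mu N B))
              <= - ereal_inf (I @` closure B)]].

Definition good_rate (R : realType) (X : topologicalType) (I : X -> \bar R) :
    Prop :=
  forall a : R, (0 <= a)%R -> compact [set x | I x <= a%:E].

Definition strictly_quasi_convex (R : realType) (V : lmodType R)
    (f : V -> \bar R) : Prop :=
  (forall x, -oo < f x) /\
  forall (x1 x2 : V) (theta : R), x1 <> x2 -> f x1 < +oo -> f x2 < +oo ->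
    (0 < theta < 1)%R ->
    f (theta *: x1 + (1 - theta) *: x2)%R < maxe (f x1) (f x2).

Definition mutually_independent d (T : measurableType d) d'
    (T' : measurableType d') (R : realType) (P : probability T R)
    (A : finType) (X : A -> {RV P >-> T'}) : Prop :=
  forall (J : {set A}) (B : A -> set T'), (forall a, measurable (B a)) ->
    P (\bigcap_(a in [set` J]) (X a @^-1` B a)) =
    \prod_(a in J) P (X a @^-1` B a).

(* Indices run from 0: [i : 'I_n] is the mathematical index [i + 1], and
   [bool] plays the role of the two signs.  The word
   [sigma_1 ... sigma_(i+1)] has length [depth k N i]. *)
Definition depth n (k : 'I_n -> nat -> nat) (N : nat) (i : 'I_n) : nat :=
  (\sum_(j < n | (j <= i)%N) k j N)%N.

(* When [\sum_j k j N = N], one has [depth k N i <= N] and the default value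
   of [nth] is never reached. *)
Definition prefix_of n (k : 'I_n -> nat -> nat) (N : nat) (i : 'I_n)
    (sigma : N.-tuple bool) : (depth k N i).-tuple bool :=
  [tuple nth true sigma l | l < depth k N i].

(* The tree of all words [sigma_1 ... sigma_(i+1)]; words are tagged with their
   level, since levels with [k j N = 0] do not lengthen the word. *)
Definition node n (k : 'I_n -> nat -> nat) (N : nat) : finType :=
  {i : 'I_n & (depth k N i).-tuple bool}.

Section empirical_measure.
Context d (T : measurableType d) (R : realType) (P : probability T R).
Variables (n : nat) (k : 'I_n -> nat -> nat).
Variable xi :
  forall (N : nat) (i : 'I_n), (depth k N i).-tuple bool -> {RV P >-> R}.

Definition node_rv (N : nat) (v : node k N) : {RV P >-> R} :=
  xi (tagged v).

Definition leaf (N : nat) (sigma : N.-tuple bool) (w : T) : 'rV[R]_n :=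
  (\row_i xi (prefix_of k i sigma) w)%R.

Local Notation borel_rV :=
  (g_sigma_algebraType [set U : set 'rV[R]_n | open U]).

Definition empirical_measure (N : nat) (w : T) (B : set borel_rV) : \bar R :=
  ((2 ^+ N)^-1)%:E *
  \sum_(sigma : N.-tuple bool) \d_(leaf sigma w : borel_rV) B.

Section empirical_measure_is_probability.
Variables (N : nat) (w : T).

Let empirical0 : empirical_measure N w set0 = 0.
Proof. by rewrite /empirical_measure big1 ?mule0// => s _; rewrite measure0. Qed.

Let empirical_ge0 B : 0 <= empirical_measure N w B.
Proof.
by rewrite mule_ge0 ?sume_ge0// lee_fin invr_ge0 exprn_ge0.
Qed.

Let empirical_sigma_additive : semi_sigma_additive (empirical_measure N w).
Proof.
move=> F mF tF mUF; rewrite [X in X @ _ --> _](_ : _ = fun m =>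
  ((2 ^+ N)^-1)%:E * \sum_(s : N.-tuple bool)
    \sum_(0 <= i < m) \d_(leaf s w : borel_rV) (F i)); last first.
  apply/funext => m; rewrite exchange_big/= ge0_sume_distrr// => i _.
  by rewrite sume_ge0.
apply: cvgeZl => //; apply: cvg_nnesum => [s _|s _];
  last exact: measure_semi_sigma_additive.
by apply: nearW => m; rewrite sume_ge0.
Qed.

HB.instance Definition _ := isMeasure.Build _ _ _ (empirical_measure N w)
  empirical0 empirical_ge0 empirical_sigma_additive.

Let empirical_setT : empirical_measure N w setT = 1.
Proof.
rewrite /empirical_measure (eq_bigr (fun=> 1)) => [|s _]; last exact: diracT.
rewrite sumEFin sumr_const card_tuple card_bool -EFinM natrX mulVf//.
Qed.

HB.instance Definition _ := Measure_isProbability.Build _ _ _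
  (empirical_measure N w) empirical_setT.

End empirical_measure_is_probability.
End empirical_measure.

Section rate_function.
Context (R : realType) (n : nat).
Variables (p : 'I_n -> R) (I : 'I_n -> R -> \bar R).

Definition admissible : set 'rV[R]_n :=
  [set x | forall j : 'I_n,
     \sum_(i < n | (i <= j)%N) I i (x ord0 i)
       <= (\sum_(i < n | (i <= j)%N) p i * ln 2)%:E].

Definition cascade_rate (x : 'rV[R]_n) : \bar R :=
  if x \in admissible then \sum_(i < n) I i (x ord0 i) else +oo.

End rate_function.

(* Main.v *)
Require Import Defs.
From mathcomp Require Import all_boot all_order all_algebra.
From mathcomp Require Import all_classical all_reals all_analysis.
From mathcomp Require Import measurable_realfun.
From mathcomp Require Import ring lra.
Import Order.TTheory GRing.Theory Num.Theory.
Import numFieldNormedType.Exports.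
Local Open Scope classical_set_scope.
Local Open Scope ring_scope.
Set Implicit Arguments.
Unset Strict Implicit.
Unset Printing Implicit Defensive.

(** Everything is read off boxes, that is, products [B] of one set [B i] of
real numbers per coordinate.  Write [q i] for the mass that the law of level
[i] gives to [B i]; by the large deviation principle of that level it is about
[exp (- N inf_(B i) I i)].  Each of the [2 ^ N] branches of the tree lies in
the box with probability [\prod_i q i], so this product is the mean of the
empirical measure of the box, which explains the sum of the [I i] in the rate.

The constraints defining the domain tell when the empirical measure follows
its mean.  There are about [exp (N (p_1 + ... + p_j) ln 2)] words at level [j],
each of which meets the first [j] constraints of the box with probability
[\prod_(i <= j) q i].
- If for some [j] the expected number of such words is exponentially small,
  then Markov's inequality and the Borel-Cantelli lemma show that eventually
  there are none, and that no branch at all reaches the box ([box_empty]).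
- In any case, the same two tools bound the empirical measure of the box by
  its mean, up to an arbitrarily small loss in the exponent ([box_upper]).
- If for every [j] the expected number is exponentially large, then the
  second moment method applies: two branches which separate after level [j]
  contribute the inverse of the expected number of words at level [j] to the
  relative variance, so that eventually the empirical measure of the box is at
  least half its mean ([box_lower]).

Almost surely, these estimates hold simultaneously for the countably many boxes
with rational sides ([ae_typical]).  For such an outcome the large deviation
principle is deterministic.  For a closed set, goodness of the [I i] reduces
to a compact set ([decays_far]), which lower semicontinuity covers by finitely
many boxes with the right decay ([decays_nbhs], [typical_upper]).  For an open
set and a point [x] of the domain, the constraints may hold with equality at
[x], where the second moment method says nothing.  But strict quasi-convexity
provides, arbitrarily close to each coordinate of positive rate, a point of
strictly smaller rate ([rate_decrease]); moving these coordinates makes all the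
constraints strict without increasing the rate ([typical_lower]). *)

(** * Large deviations as exponential bounds *)

Section exponential_bounds.
Context {R : realType}.
Implicit Types (x y : \bar R) (r c : R).

Lemma ereal_lt_dense x y : (x < y)%E -> exists2 r, (x < r%:E)%E & (r%:E < y)%E.
Proof.
case: x y => [a| |] [b| |] //= ab.
- by exists ((a + b) / 2); move: ab; rewrite !lte_fin => ab; lra.
- by exists (a + 1); rewrite ?ltry// lte_fin; lra.
- by exists (b - 1); rewrite ?ltNyr// lte_fin; lra.
- by exists 0; rewrite ?ltry ?ltNyr.
Qed.

Lemma lne_le_expR x r : (lne x <= r%:E)%E = (x <= (expR r)%:E)%E.
Proof.
case: x => [a| |]//=; last by rewrite !leNye.
case: ifPn => a0; first by rewrite leNye lee_fin (le_trans a0)// expR_ge0.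
by rewrite !lee_fin -ler_expR lnK// posrE ltNge.
Qed.

Lemma expR_le_lne x r : (r%:E <= lne x)%E = ((expR r)%:E <= x)%E.
Proof.
case: x => [a| |]//=; last by rewrite !leey.
case: ifPn => a0.
  rewrite leeNy_eq/= lee_fin; apply/esym/negbTE.
  by rewrite -ltNge (le_lt_trans a0)// expR_gt0.
by rewrite !lee_fin -ler_expR lnK// posrE ltNge.
Qed.

(** Through these two lemmas, the limits in the definition of a large deviation
principle become eventual exponential bounds on the measures themselves. *)
Lemma speed_le (N : nat) x r : (0 < N)%N ->
  ((N%:R^-1)%:E * lne x <= r%:E)%E = (x <= (expR (r * N%:R))%:E)%E.
Proof.
by move=> N0; rewrite lee_pdivrMl ?ltr0n// -EFinM lne_le_expR mulrC.
Qed.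

Lemma speed_ge (N : nat) x r : (0 < N)%N ->
  (r%:E <= (N%:R^-1)%:E * lne x)%E = ((expR (r * N%:R))%:E <= x)%E.
Proof.
by move=> N0; rewrite lee_pdivlMl ?ltr0n// -EFinM expR_le_lne mulrC.
Qed.

Lemma limn_esup_lt (u : nat -> \bar R) r :
  (limn_esup u < r%:E)%E -> \forall N \near \oo, (u N <= r%:E)%E.
Proof.
rewrite /limn_esup limf_esupE => /ereal_inf_ltP[_ [V FV <-] Vr].
apply: filterS FV => N VN; apply: ltW; apply: le_lt_trans Vr.
by apply: ereal_sup_ubound; exists N.
Qed.

Lemma limn_esup_le (u : nat -> \bar R) r :
  (\forall N \near \oo, (u N <= r%:E)%E) -> (limn_esup u <= r%:E)%E.
Proof.
move=> ur; rewrite /limn_esup limf_esupE.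
apply: ge_ereal_inf; exists (ereal_sup (u @` [set N | (u N <= r%:E)%E])).
  by exists [set N | (u N <= r%:E)%E].
by apply: ge_ereal_sup => _ [N /= uN <-].
Qed.

Lemma limn_einf_gt (u : nat -> \bar R) r :
  (r%:E < limn_einf u)%E -> \forall N \near \oo, (r%:E <= u N)%E.
Proof.
rewrite /limn_einf lteNr -EFinN => /limn_esup_lt.
by apply: filterS => N; rewrite EFinN leeN2.
Qed.

Lemma limn_einf_ge (u : nat -> \bar R) r :
  (\forall N \near \oo, (r%:E <= u N)%E) -> (r%:E <= limn_einf u)%E.
Proof.
move=> ur; rewrite /limn_einf leeNr -EFinN; apply: limn_esup_le.
by apply: filterS ur => N; rewrite EFinN leeN2.
Qed.

End exponential_bounds.

Section LDP_exponential.
Context {R : realType} {X : topologicalType}.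
Variables (mu : nat -> set X -> \bar R) (I : X -> \bar R).
Let borel (B : set X) := (<<s [set U : set X | open U] >>) B.

Let borel_open U : open U -> borel U.
Proof. exact: sub_sigma_algebra. Qed.

Let borel_closed C : closed C -> borel C.
Proof.
move=> Ccl; have /sigma_algebraCD := borel_open (closed_openC Ccl).
by rewrite /borel setTD setCK.
Qed.

Lemma LDP_upper (C : set X) (c c' : R) : LDP mu I -> closed C ->
    (forall x, C x -> (c%:E <= I x)%E) -> c' < c ->
  \forall N \near \oo, (mu N C <= (expR (- c' * N%:R))%:E)%E.
Proof.
move=> [_ _ /(_ _ (borel_closed _))] ldp Ccl cI c'c.
have [_ _] := ldp _ Ccl; rewrite -(closure_id C).1// => Cle.
have : (limn_esup (fun N : nat => (N%:R^-1)%:E * lne (mu N C)) < (- c')%:E)%E.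
  apply: le_lt_trans Cle _; rewrite lteNl -EFinN opprK.
  apply: (@lt_le_trans _ _ c%:E); first by rewrite lte_fin.
  by apply/ereal_infP => _ [x Cx <-]; exact: cI.
move=> /limn_esup_lt; apply: filterS2 (nbhs_infty_gt 0) => N N0.
by rewrite speed_le.
Qed.

Lemma LDP_lower (U : set X) x (c : R) : LDP mu I -> open U -> U x ->
    (I x < c%:E)%E ->
  \forall N \near \oo, ((expR (- c * N%:R))%:E <= mu N U)%E.
Proof.
move=> [_ _ /(_ _ (borel_open _))] ldp Uop Ux Ic.
have [+ _ _] := ldp _ Uop; rewrite (interior_id _).1// => Ule.
have : ((- c)%:E < limn_einf (fun N : nat => (N%:R^-1)%:E * lne (mu N U)))%E.
  apply: lt_le_trans Ule; rewrite lteNr -EFinN opprK.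
  by apply/ereal_inf_ltP; exists (I x) => //; exists x.
move=> /limn_einf_gt; apply: filterS2 (nbhs_infty_gt 0) => N N0.
by rewrite speed_ge.
Qed.

(** The two bounds need only be checked on closed and on open sets, with real
numbers in place of the possibly infinite infima. *)
Lemma LDP_intro : (forall x, 0 <= I x)%E -> lower_semicontinuous I ->
    (forall N A B, A `<=` B -> (mu N A <= mu N B)%E) ->
    (forall (F : set X) (c c' : R), closed F ->
       (forall x, F x -> (c%:E <= I x)%E) -> c' < c ->
       \forall N \near \oo, (mu N F <= (expR (- c' * N%:R))%:E)%E) ->
    (forall (U : set X) x (c : R), open U -> U x -> (I x < c%:E)%E ->
       \forall N \near \oo, ((expR (- c * N%:R))%:E <= mu N U)%E) ->
  LDP mu I.
Proof.
move=> I0 Ilsc mono upper lower; split => // B _.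
split; [|exact: limn_einf_sup|].
- rewrite leNgt; apply/negP => /ereal_lt_dense[r infr].
  rewrite lteNr -EFinN => /ereal_inf_ltP[_ [x Bx <-]].
  move=> /(lower _ _ _ (@open_interior _ B) Bx); rewrite opprK => low.
  move: infr; rewrite ltNge => /negP; apply; apply: limn_einf_ge.
  apply: filterS2 (nbhs_infty_gt 0) low => N N0 low; rewrite speed_ge//.
  by apply: le_trans low _; apply: mono; exact: interior_subset.
- rewrite leNgt; apply/negP => /ereal_lt_dense[r +].
  rewrite lteNl -EFinN => /ereal_lt_dense[c rc cinf].
  have cI x : closure B x -> (c%:E <= I x)%E.
    move=> Bx; apply: le_trans (ltW cinf) _.
    by apply: ereal_inf_lbound; exists x.
  move: rc; rewrite lte_fin => /(upper _ _ _ (@closed_closure _ B) cI).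
  rewrite opprK ltNge => up /negP; apply; apply: limn_esup_le.
  apply: filterS2 (nbhs_infty_gt 0) up => N N0 up; rewrite speed_le//.
  by apply: le_trans up; apply: mono; exact: subset_closure.
Qed.

End LDP_exponential.

(** * Moment bounds for the number of events that occur *)

Section moments.
Context {d} {T : measurableType d} {R : realType} (P : probability T R).

Lemma borel_cantelli_expR (A : nat -> set T) (C e : R) :
    (forall N, measurable (A N)) -> 0 <= C -> 0 < e ->
    (\forall N \near \oo, (P (A N) <= (C * expR (- e * N%:R))%:E)%E) ->
  {ae P, forall w, \forall N \near \oo, ~ A N w}.
Proof.
move=> mA C0 e0 [N0 _ AN0].
(* the bound is only known from [N0] on *)
pose F N := A (N + N0)%N; pose x := expR (- e).
have x0 : 0 < x by rewrite expR_gt0.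
have x1 : `|x| < 1 by rewrite gtr0_norm// expR_lt1 oppr_lt0.
have F0 : P (lim_sup_set F) = 0%E.
  apply: lim_sup_set_cvg0 => [N|]; first exact: mA.
  apply: (@le_lt_trans _ _ (C * (1 - x)^-1)%:E); last by rewrite ltry.
  apply: lime_le; first by apply: is_cvg_nneseries => N _ _; exact: measure_ge0.
  apply: nearW => M; rewrite -lee_fin in C0.
  apply: (@le_trans _ _ (series (geometric C x) M)%:E); last first.
    by rewrite lee_fin geometric_le_lim.
  rewrite /series/= -sumEFin; apply: lee_sum => N _.
  apply: le_trans (AN0 (N + N0)%N (leq_addl _ _)) _.
  rewrite lee_fin ler_wpM2l// /x -expRM_natr ler_expR !mulNr lerN2.
  by rewrite ler_pM2l// ler_nat leq_addr.
exists (lim_sup_set F); split => //.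
  apply: bigcap_measurable => // i _; apply: bigcup_measurable => j _.
  exact: mA.
move=> w /= nA N _; apply: contrapT => nF; apply: nA.
exists (N + N0)%N => //= M NM AM; apply: nF; exists (M - N0)%N => /=.
  by rewrite leq_subRL ?(leq_trans (leq_addl _ _) NM)// addnC.
by rewrite /F subnK// (leq_trans (leq_addl _ _) NM).
Qed.

Context {J : finType} (A : J -> set T).
Hypothesis mA : forall j, measurable (A j).

Definition occurrences (w : T) : R := \sum_(j : J) \1_(A j) w.

Lemma occurrences_ge0 w : 0 <= occurrences w.
Proof. by apply: sumr_ge0. Qed.

Lemma measurable_occurrences : measurable_fun setT occurrences.
Proof. by apply: measurable_sum => j; exact: measurable_indic. Qed.

Lemma measurable_occurrences_ge t : measurable [set w | t <= occurrences w].
Proof.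
rewrite (_ : [set _ | _] = setT `&` occurrences @^-1` [set` `[t, +oo[%R]).
  by apply: measurable_occurrences => //; exact: measurable_itv.
by apply/seteqP; split => w /=; rewrite in_itv/= andbT => // -[].
Qed.

Lemma measurable_occurrences_lt t : measurable [set w | occurrences w < t].
Proof.
rewrite (_ : [set _ | _] = ~` [set w | t <= occurrences w]).
  by apply: measurableC; exact: measurable_occurrences_ge.
by apply/seteqP; split => w /=; rewrite ltNge => /negP.
Qed.

Lemma integral_occurrences : (\int[P]_w (occurrences w)%:E = \sum_j P (A j))%E.
Proof.
under eq_integral do rewrite /occurrences -sumEFin.
rewrite ge0_integral_sum//.
- by apply: eq_bigr => j _; rewrite integral_indic// setIT.
- by move=> j; apply/measurable_EFinP; exact: measurable_indic.
Qed.

Lemma first_moment (t : R) : 0 < t ->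
  (P [set w | t <= occurrences w]%R <= (t^-1)%:E * \sum_j P (A j))%E.
Proof.
move=> t0; rewrite lee_pdivlMl// -integral_occurrences -(setIT [set _ | _]).
have mE := measurable_occurrences_ge t.
rewrite -integral_indic// -ge0_integralZl_EFin//; last 2 first.
- by apply/measurable_EFinP; exact: measurable_indic.
- exact: ltW.
apply: ge0_le_integral => //.
- by move=> w _; rewrite -EFinM lee_fin mulr_ge0// ltW.
- by apply/measurable_EFinP; apply: measurable_funM.
- by apply/measurable_EFinP; exact: measurable_occurrences.
move=> w _; rewrite -EFinM lee_fin indicE; case: (boolP (w \in _)) => [|_].
  by rewrite inE/= mulr1.
by rewrite mulr0 occurrences_ge0.
Qed.

(** Chebyshev's inequality, arranged as a comparison of integrals of
nonnegative functions, which avoids integrability conditions. *)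
Lemma second_moment (m V : R) : 0 < m -> (\sum_j P (A j) = m%:E)%E ->
    (\sum_i \sum_j P (A i `&` A j) <= V%:E)%E ->
  (P [set w | occurrences w < m / 2]%R <= (4 * (V / m ^+ 2 - 1))%R%:E)%E.
Proof.
move=> m0 Am AV; set E := [set _ | _].
have mE : measurable E := measurable_occurrences_lt (m / 2).
have moccurrences := measurable_occurrences.
have mIE : measurable_fun setT (\1_E : T -> R) by exact: measurable_indic.
have : (\int[P]_w ((m ^+ 2 / 4)%:E * (\1_E w)%:E +
                   (2 * m)%:E * (occurrences w)%:E)
    <= \int[P]_w (((occurrences w) ^+ 2)%:E + (m ^+ 2)%:E))%E.
  apply: ge0_le_integral => //.
  - move=> w _; rewrite -!EFinM -EFinD lee_fin; apply: addr_ge0.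
      by rewrite mulr_ge0// divr_ge0// exprn_ge0// ltW.
    by rewrite mulr_ge0 ?occurrences_ge0// mulr_ge0// ltW.
  - by apply: emeasurable_funD; apply/measurable_EFinP; apply: measurable_funM.
  - apply: emeasurable_funD => //; apply/measurable_EFinP.
    exact: measurable_funX.
  move=> w _; rewrite -!EFinM -!EFinD lee_fin indicE.
  (* the right-hand side minus [2 * m * occurrences w] is the square of
     [occurrences w - m], which is at least [m / 2] in absolute value on [E] *)
  case: (boolP (w \in E)) => [|_]; last first.
    by rewrite mulr0 add0r; have := sqr_ge0 (occurrences w - m); lra.
  rewrite inE /E/= => wE; have := occurrences_ge0 w => w0; rewrite mulr1; nra.
have occurrences2 w : (((occurrences w) ^+ 2)%:E =
    \sum_i \sum_j (\1_(A i `&` A j) w)%:E)%E.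
  rewrite expr2 /occurrences mulr_suml -sumEFin; apply: eq_bigr => i _.
  by rewrite mulr_sumr -sumEFin; apply: eq_bigr => j _; rewrite indicI.
rewrite ge0_integralD//; last 4 first.
- by move=> w _; rewrite -EFinM lee_fin mulr_ge0// divr_ge0// exprn_ge0// ltW.
- by apply/measurable_EFinP; exact: measurable_funM.
- move=> w _; rewrite -EFinM lee_fin mulr_ge0 ?occurrences_ge0//.
  by rewrite mulr_ge0// ltW.
- by apply/measurable_EFinP; exact: measurable_funM.
rewrite !ge0_integralZl_EFin//; last 5 first.
- by move=> w _; rewrite lee_fin occurrences_ge0.
- exact/measurable_EFinP.
- by rewrite mulr_ge0// ltW.
- exact/measurable_EFinP.
- by rewrite divr_ge0// exprn_ge0// ltW.
rewrite integral_indic// setIT integral_occurrences Am.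
rewrite ge0_integralD//; last 3 first.
- by move=> w _; rewrite lee_fin sqr_ge0.
- by apply/measurable_EFinP; exact: measurable_funX.
- by move=> w _; rewrite lee_fin sqr_ge0.
rewrite [X in (_ <= _ + X)%E]integral_cst//= probability_setT mule1.
under [X in (_ <= X + _)%E]eq_integral do rewrite occurrences2.
have mAA i j : measurable (A i `&` A j) by exact: measurableI.
have -> : (\int[P]_w \sum_i \sum_j (\1_(A i `&` A j) w)%:E
           = \sum_i \sum_j P (A i `&` A j))%E.
  rewrite ge0_integral_sum//.
  - apply: eq_bigr => i _; rewrite ge0_integral_sum//.
      by apply: eq_bigr => j _; rewrite integral_indic// setIT.
    by move=> j; apply/measurable_EFinP; exact: measurable_indic.
  - move=> i; apply: emeasurable_sum => j.
    by apply/measurable_EFinP; exact: measurable_indic.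
  - by move=> i w _; apply: sume_ge0 => j _; rewrite lee_fin.
move=> /le_trans /(_ (leeD2r _ AV)).
rewrite -(fineK (fin_num_measure P _ mE)).
rewrite -!EFinM -!EFinD !lee_fin => le.
have m20 : 0 < m ^+ 2 by rewrite exprn_gt0.
rewrite mulrBr mulr1 lerBrDr mulrA ler_pdivlMr//; lra.
Qed.

End moments.

Lemma ae_countable d (T : measurableType d) (R : realType)
    (P : probability T R) (J : countType) (Q : J -> T -> Prop) :
  (forall j, {ae P, forall w, Q j w}) -> {ae P, forall w, forall j, Q j w}.
Proof.
move=> aeQ; pose Q' m w := if unpickle m is Some j then Q j w else True.
have : {ae P, forall w, forall m, Q' m w}.
  apply: ae_foralln => m; rewrite /Q'.
  by case: unpickle => [j|]; [exact: aeQ|exact/aeW].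
by apply: filterS => w Q'w j; have := Q'w (pickle j); rewrite /Q' pickleK.
Qed.

(** * Rate functions on the line and on the product space *)

Section levels.
Context {n : nat}.

Definition upto (j : 'I_n) : {set 'I_n} := [set i : 'I_n | (i <= j)%N]%SET.

Definition box {R : realType} (B : 'I_n -> set R) : set 'rV[R]_n :=
  [set x | forall i, B i (x ord0 i)].

End levels.

Section preliminaries.
Context {R : realType}.

Lemma expR_absorb (C a b : R) : a < b ->
  \forall N \near \oo, C * expR (- b * N%:R) <= expR (- a * N%:R).
Proof.
move=> ab; apply: filterS (nbhs_infty_ger (C / (b - a))) => N.
rewrite ler_pdivrMr ?subr_gt0// mulrC => CN.
have -> : - a * N%:R = (b - a) * N%:R + - b * N%:R by ring.
rewrite expRD ler_wpM2r ?expR_ge0// (le_trans CN)//.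
by apply: le_trans (expR_ge1Dx _); rewrite lerDr.
Qed.

(** If some [f i] is infinite, the corresponding [c i] absorbs all the others;
otherwise the slack is shared equally between the terms. *)
Lemma esum_gt_split (J : finType) (S : {set J}) (f : J -> \bar R) (a : R) :
    (forall i, -oo < f i)%E -> (a%:E < \sum_(i in S) f i)%E ->
  exists2 c : J -> R, (forall i, ((c i)%:E < f i)%E) & a < \sum_(i in S) c i.
Proof.
move=> fNy af.
have bf e i : 0 < e -> ((fine (f i) - e)%:E < f i)%E.
  move=> e0; case: (f i) (fNy i) => [r| |]//= _; rewrite ?ltry//.
  by rewrite lte_fin ltrBlDr ltrDl.
have [/existsP[i0 /andP[i0S /eqP fi0]]|/existsPn ffin] :=
    boolP [exists i, (i \in S) && (f i == +oo%E)].
  pose b i := fine (f i) - 1.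
  exists (fun i => if i == i0
                   then a + 1 - \sum_(l in S | l != i0) b l else b i).
    by move=> i; case: eqP => [->|_]; [rewrite fi0 ltry|exact: bf].
  rewrite (bigD1 i0)//= eqxx.
  rewrite [X in _ + X](eq_bigr b) => [|i /andP[_ /negbTE->]//].
  by rewrite subrK ltrDl.
have fS i : i \in S -> f i = (fine (f i))%:E.
  move=> iS; rewrite fineK// fin_real// fNy/= ltey.
  by have := ffin i; rewrite iS.
move: af; rewrite (eq_bigr (fun i => (fine (f i))%:E)) => [|i /fS//].
rewrite sumEFin lte_fin => af.
pose e := (\sum_(i in S) fine (f i) - a) / (#|S|%:R + 1).
have S0 : 0 < #|S|%:R + 1 :> R by rewrite ltr_wpDl.
have e0 : 0 < e by rewrite divr_gt0// subr_gt0.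
exists (fun i => fine (f i) - e); first by move=> i; exact: bf.
rewrite sumrB sumr_const -mulr_natr.
have : e * (#|S|%:R + 1) = \sum_(i in S) fine (f i) - a.
  by rewrite /e divfK// gt_eqF.
lra.
Qed.

Lemma nbhs_box (n : nat) (x : 'rV[R]_n) (B : 'I_n -> set R) :
  (forall i, nbhs (x ord0 i) (B i)) -> nbhs x (box B).
Proof.
move=> xB; apply: (@filter_forall _ _
  (fun i => [set y : 'rV[R]_n | B i (y ord0 i)]) (nbhs x) _ _) => i.
exact: (@coord_continuous _ _ _ ord0 i x).
Qed.

Lemma nbhs_rat_itv (x : R) (V : set R) : nbhs x V ->
  exists qr : rat * rat, ratr qr.1 < x < ratr qr.2 /\
    [set` `[ratr qr.1, ratr qr.2]] `<=` V.
Proof.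
move=> /nbhs_ballP[e /= e0 xV].
have [q] : exists q : rat, ratr q \in `](x - e), x[ by apply: rat_in_itvoo; lra.
rewrite in_itv/= => /andP[eq qx].
have [r] : exists r : rat, ratr r \in `]x, (x + e)[ by apply: rat_in_itvoo; lra.
rewrite in_itv/= => /andP[xr re].
exists (q, r); rewrite /= qx xr; split => // y /=.
rewrite in_itv/= => /andP[qy yr].
by apply: xV; rewrite /ball/= ltr_norml; lra.
Qed.

Lemma nbhs_boxP (n : nat) (x : 'rV[R]_n) (U : set 'rV[R]_n) : nbhs x U ->
  exists2 B : 'I_n -> set R, forall i, nbhs (x ord0 i) (B i) & box B `<=` U.
Proof.
move=> /nbhs_ballP[e /= e0 xU].
exists (fun i => ball (x ord0 i) e) => [i|y xy]; first exact: nbhsx_ballx.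
by apply: xU; split => // i j; rewrite ord1; exact: xy.
Qed.

End preliminaries.

Section rate_functions.
Context {R : realType} (n : nat) (I : 'I_n -> R -> \bar R) (p : 'I_n -> R).
Hypothesis I_ge0 : forall i x, (0 <= I i x)%E.
Hypothesis I_lsc : forall i, lower_semicontinuous (I i).
Implicit Types (x y : 'rV[R]_n) (S : {set 'I_n}).

Lemma sum_rate_nbhs x S (a : R) : (a%:E < \sum_(i in S) I i (x ord0 i))%E ->
  exists2 c : 'I_n -> R, a < \sum_(i in S) c i &
    forall i, exists2 b, c i < b & nbhs (x ord0 i) [set u | (b%:E < I i u)%E].
Proof.
move=> /esum_gt_split[i|c /(_ _)/ereal_lt_dense cI ac].
  exact: lt_le_trans (I_ge0 _ _).
exists c => // i; have [b cb bI] := cI i; exists b; first by rewrite -lte_fin.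
by have [V xV VI] := I_lsc bI; exact: filterS xV.
Qed.

Lemma sum_rate_lsc x S (a : R) : (a%:E < \sum_(i in S) I i (x ord0 i))%E ->
  nbhs x [set y : 'rV[R]_n | (a%:E < \sum_(i in S) I i (y ord0 i))%E].
Proof.
move=> /sum_rate_nbhs[c ac cI].
have /nbhs_box : forall i, nbhs (x ord0 i) [set u | ((c i)%:E < I i u)%E].
  move=> i; have [b cb] := cI i; apply: filterS => u /=.
  by apply: lt_trans; rewrite lte_fin.
apply: filterS => y cy.
apply: (@lt_le_trans _ _ (\sum_(i in S) c i)%:E); first by rewrite lte_fin.
by rewrite -sumEFin; apply: lee_sum => i _; exact/ltW/cy.
Qed.

Lemma admissibleP x : admissible p I x <-> forall j,
  (\sum_(i in upto j) I i (x ord0 i) <= ((\sum_(i in upto j) p i) * ln 2)%:E)%E.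
Proof.
have uptoE (V : nmodType) (f : 'I_n -> V) (j : 'I_n) :
    \sum_(i < n | (i <= j)%N) f i = \sum_(i in upto j) f i.
  by apply: eq_bigl => i; rewrite inE.
by split => xD j; have := xD j; rewrite mulr_suml !uptoE.
Qed.

Lemma not_admissible x : ~ admissible p I x -> exists j,
  (((\sum_(i in upto j) p i) * ln 2)%:E < \sum_(i in upto j) I i (x ord0 i))%E.
Proof.
move=> xD; apply: contrapT => /forallNP xj; apply: xD.
by apply/admissibleP => j; rewrite leNgt; exact/negP.
Qed.

Lemma cascade_rateE x : admissible p I x ->
  cascade_rate p I x = (\sum_i I i (x ord0 i))%E.
Proof. by move=> xD; rewrite /cascade_rate mem_set. Qed.

Lemma cascade_rate_infty x : ~ admissible p I x -> cascade_rate p I x = +oo%E.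
Proof. by move=> xD; rewrite /cascade_rate memNset. Qed.

Lemma cascade_rate_ge x : (\sum_i I i (x ord0 i) <= cascade_rate p I x)%E.
Proof.
have [/cascade_rateE->//|/cascade_rate_infty->] := pselect (admissible p I x).
exact: leey.
Qed.

Lemma cascade_rate_ge0 x : (0 <= cascade_rate p I x)%E.
Proof. by apply: le_trans (cascade_rate_ge x); apply: sume_ge0. Qed.

(** A point of large rate either violates one of the constraints defining the
domain or has a large sum; both are detected by a partial sum of the lower
semicontinuous functions [I i]. *)
Lemma cascade_rate_gt x (c : R) : (c%:E < cascade_rate p I x)%E ->
  (exists j, (((\sum_(i in upto j) p i) * ln 2)%:E <
     \sum_(i in upto j) I i (x ord0 i))%E) \/
  (c%:E < \sum_(i in finset.setT) I i (x ord0 i))%E.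
Proof.
have [xD|xD] := pselect (admissible p I x); last by left; exact: not_admissible.
rewrite cascade_rateE// => cx; right; rewrite (eq_bigl xpredT)// => i.
by rewrite inE.
Qed.

Lemma cascade_rate_lsc : lower_semicontinuous (cascade_rate p I).
Proof.
move=> x a /cascade_rate_gt[[j]|] /sum_rate_lsc xV.
  exists [set y | ~ admissible p I y] => [|y /cascade_rate_infty->];
    last by rewrite ltry.
  by apply: filterS xV => y yj /admissibleP/(_ j); rewrite leNgt yj.
eexists; first exact: xV.
move=> y /= /lt_le_trans; apply; apply: le_trans (cascade_rate_ge y).
by rewrite (eq_bigl xpredT)// => i; rewrite inE.
Qed.

End rate_functions.

Section one_rate.
Context {R : realType} (lambda : nat -> probability R R) (I : R -> \bar R).
Hypothesis I_LDP : LDP lambda I.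

(** A probability measure charges the whole space, so the rate function has
infimum [0]. *)
Lemma inf_rate (e : R) : 0 < e -> exists z, (I z < e%:E)%E.
Proof.
move=> e0; apply: contrapT => /forallNP eI.
have : \forall N \near \oo, (lambda N setT <= (expR (- (e / 2) * N%:R))%:E)%E.
  apply: (LDP_upper (c := e) I_LDP) => [|x _|]; [exact: closedT| |by lra].
  by rewrite leNgt; exact/negP.
move=> [N0 _ /(_ N0.+1 (leqnSn _))].
rewrite probability_setT lee_fin leNgt => /negP; apply.
by rewrite expR_lt1 mulNr oppr_lt0 mulr_gt0// divr_gt0.
Qed.

Hypothesis I_sqc : strictly_quasi_convex (I : R^o -> \bar R).

(** Strict quasi-convexity excludes plateaus: moving slightly from [x] towards
a point of smaller rate strictly decreases the rate. *)
Lemma rate_decrease x (V : set R) : nbhs x V -> (I x < +oo)%E ->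
  exists y, [/\ V y, (I y <= I x)%E & (0 < I x)%E -> (I y < I x)%E].
Proof.
move=> xV Ixoo; have [I0|I0] := ltP 0%E (I x); last first.
  by exists x; split => //; exact: nbhs_singleton xV.
have [e e0 eI] := ereal_lt_dense I0.
have [z zI] := inf_rate e0.
have {eI}zx : (I z < I x)%E := lt_trans zI eI.
have towards : (t * z + (1 - t) * x) @[t --> (0 : R)^'+] --> x.
  rewrite [X in _ --> X](_ : _ = 0 * z + (1 - 0) * x); last first.
    by rewrite mul0r add0r subr0 mul1r.
  apply: cvg_at_right_filter; apply: cvgD; apply: cvgM;
    [exact: cvg_id|exact: cvg_cst| |exact: cvg_cst].
  by apply: cvgB; [exact: cvg_cst|exact: cvg_id].
near (0 : R)^'+ => t.
have yx : (I (t * z + (1 - t) * x) < I x)%E.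
  rewrite -[ltRHS](max_idPr (ltW zx)); apply: (I_sqc.2 z x t).
  - by move=> zxE; move: zx; rewrite zxE ltxx.
  - exact: lt_trans Ixoo.
  - exact: Ixoo.
  - by apply/andP; split; near: t; [exact: nbhs_right_gt|exact: nbhs_right_lt].
exists (t * z + (1 - t) * x); split => //; last exact: ltW.
by near: t; exact: towards.
Unshelve. all: by end_near.
Qed.

End one_rate.

(** * Branches of the tree *)

Section words.
Variables (n : nat) (k : 'I_n -> nat -> nat) (N : nat).
Hypothesis depth_le : forall i, (depth k N i <= N)%N.

Lemma leq_depth (i j : 'I_n) : (i <= j)%N -> (depth k N i <= depth k N j)%N.
Proof.
move=> ij; rewrite /depth [X in (X <= _)%N]big_mkcond/=.
rewrite [X in (_ <= X)%N]big_mkcond/=; apply: leq_sum => l _.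
by case: ifP => // li; rewrite (leq_trans li ij).
Qed.

Lemma val_prefix_of i (s : N.-tuple bool) :
  val (prefix_of k i s) = take (depth k N i) s.
Proof.
rewrite -(map_nth_iota0 true) ?size_tuple//.
by rewrite -[in RHS]val_enum_ord -map_comp.
Qed.

Definition agree (s t : N.-tuple bool) (i : 'I_n) : bool :=
  prefix_of k i s == prefix_of k i t.

Lemma agreeE s t i :
  agree s t i = (take (depth k N i) s == take (depth k N i) t).
Proof. by rewrite /agree -val_eqE !val_prefix_of. Qed.

Lemma agree_le s t (i j : 'I_n) : (i <= j)%N -> agree s t j -> agree s t i.
Proof.
rewrite !agreeE => ij /eqP st; apply/eqP.
by rewrite -(minn_idPl (leq_depth ij)) !take_min st.
Qed.

Lemma card_agree s j :
  #|[set t | agree s t j]%SET| = (2 ^ (N - depth k N j))%N.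
Proof.
set K := depth k N j; have KN : (K <= N)%N by exact: depth_le.
have sz (u : (N - K).-tuple bool) : size (take K s ++ u) == N.
  by rewrite size_cat size_takel ?size_tuple ?subnKC.
pose f u : N.-tuple bool := Tuple (sz u).
have finj : injective f.
  move=> u v /(congr1 val)/= /eqP.
  by rewrite eqseq_cat// eqxx/= => /eqP/val_inj.
transitivity #|f @: [set: _]%SET|; last first.
  by rewrite card_imset// cardsT card_tuple card_bool.
congr (#|pred_of_set _|); apply/setP => t; rewrite inE agreeE.
apply/eqP/imsetP => [st|].
  have szt : size (drop K t) == (N - K)%N by rewrite size_drop size_tuple.
  exists (Tuple szt) => //; apply: val_inj => /=.
  by rewrite -/K in st; rewrite st cat_take_drop.
by move=> [u _ ->] /=; rewrite take_size_cat// size_takel ?size_tuple.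
Qed.

End words.

Section cascade.
Context {d} {T : measurableType d} {R : realType} (P : probability T R).
Variables (n : nat) (k : 'I_n -> nat -> nat).
Variable xi :
  forall (N : nat) (i : 'I_n), (depth k N i).-tuple bool -> {RV P >-> R}.
Variables (N : nat) (B : 'I_n -> set R) (q : 'I_n -> R).
Hypothesis depth_le : forall i, (depth k N i <= N)%N.
Hypothesis mB : forall i, measurable (B i).
Hypothesis qE : forall i (s : (depth k N i).-tuple bool),
  distribution P (xi s) (B i) = (q i)%:E.
Hypothesis indep : mutually_independent (node_rv xi (N := N)).

Let vertex (s : N.-tuple bool) (i : 'I_n) : node k N :=
  Tagged _ (prefix_of k i s).

Definition branch_in (S : {set 'I_n}) (s : N.-tuple bool) : set T :=
  [set w | forall i, i \in S -> B i (xi (prefix_of k i s) w)].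

(** The two branches visit disjoint sets of vertices along [S] and [S'], so
independence applies to the union of these two sets. *)
Lemma prob_two_branches (s t : N.-tuple bool) (S S' : {set 'I_n}) :
    (forall i, i \in S -> i \in S' -> ~~ agree k s t i) ->
  P (branch_in S s `&` branch_in S' t) =
    ((\prod_(i in S) q i) * (\prod_(i in S') q i))%:E.
Proof.
move=> dis.
pose J := vertex s @: S :|: vertex t @: S'.
have -> : branch_in S s `&` branch_in S' t =
    \bigcap_(v in [set` J]) (node_rv xi v @^-1` B (tag v)).
  apply/seteqP; split => w.
    move=> [sw tw] v /=; rewrite /J inE => /orP[] /imsetP[i iS ->].
      exact: sw.
    exact: tw.
  move=> Jw; split => i iS.
    by apply: (Jw (vertex s i)); rewrite /= /J inE imset_f.
  by apply: (Jw (vertex t i)); rewrite /= /J inE imset_f ?orbT.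
rewrite indep; last by move=> v; exact: mB.
rewrite (eq_bigr (fun v => (q (tag v))%:E)); last by move=> v _; exact: qE.
rewrite prodEFin; congr EFin.
have vinj u : injective (vertex u) by move=> i j /(congr1 tag).
rewrite (eq_bigl [in [predU vertex s @: S & vertex t @: S']]); last first.
  by move=> v; rewrite !inE.
rewrite bigU/=; last first.
  rewrite -finset.setI_eq0; apply/eqP/setP => v; rewrite !inE.
  apply/negbTE/negP => /andP[/imsetP[i iS ->] /imsetP[j jS' /eqP]].
  rewrite /vertex -tag_eqE /tag_eq/= => /andP[/eqP ij].
  case: _ / ij jS' => iS'; rewrite tagged_asE => st.
  by have := dis _ iS iS'; rewrite /agree st.
by rewrite !big_imset//= => i j _ _; exact: vinj.
Qed.

Lemma prob_branch S s : P (branch_in S s) = (\prod_(i in S) q i)%:E.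
Proof.
rewrite -[branch_in S s]setIT -(_ : branch_in finset.set0 s = setT); last first.
  by apply/seteqP; split => // w _ i; rewrite inE.
by rewrite prob_two_branches ?big_set0 ?mulr1// => i _; rewrite inE.
Qed.

Lemma measurable_branch S s : measurable (branch_in S s).
Proof.
rewrite (_ : branch_in S s =
    \bigcap_(i in [set` S]) (xi (prefix_of k i s) @^-1` B i)); last first.
  by apply/seteqP; split => w.
apply: fin_bigcap_measurable; first exact: finite_finset.
by move=> i _; exact: measurable_funPTI.
Qed.

Definition hits (S : {set 'I_n}) (w : T) : R :=
  occurrences (branch_in S) w.

Lemma hits_subset (S S' : {set 'I_n}) w : S \subset S' -> hits S' w <= hits S w.
Proof.
move=> /fintype.subsetP SS'; apply: ler_sum => s _; rewrite !indicE ler_nat.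
case: (boolP (w \in branch_in S' s)) => // /set_mem S'w.
by rewrite mem_set// => i /SS' iS'; exact: S'w.
Qed.

Lemma prob_hits_ge (S : {set 'I_n}) (t : R) : 0 < t ->
  (P [set w | t <= hits S w]%R <= (t^-1 * (2 ^+ N * \prod_(i in S) q i))%:E)%E.
Proof.
move=> t0; apply: le_trans (first_moment P _ t0) _.
  by move=> s; exact: measurable_branch.
rewrite (eq_bigr (fun=> (\prod_(i in S) q i)%:E)); last first.
  by move=> s _; exact: prob_branch.
rewrite sumEFin sumr_const card_tuple card_bool -EFinM.
by rewrite -[_ *+ (2 ^ N)]mulr_natl natrX.
Qed.

(** Whether a branch meets the constraints up to level [j] only depends on its
prefix of length [depth k N j], which is shared by [2 ^ (N - depth k N j)]
branches; one hit entails that many. *)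
Lemma hits_gap j w : hits (upto j) w < 2 ^+ (N - depth k N j) ->
  hits (upto j) w = 0.
Proof.
move=> hlt; apply/eqP; rewrite psumr_eq0//; apply/allP => s _ /=.
rewrite indicE pnatr_eq0 eqb0; apply: contraTN hlt => sw; rewrite -leNgt.
have {}sw := set_mem sw.
apply: (@le_trans _ _ (\sum_(t | agree k s t j) 1)).
  rewrite sumr_const -natrX -(card_agree depth_le s j).
  by rewrite ler_nat; apply: eq_leq; apply: eq_card => t; rewrite !inE.
rewrite big_mkcond; apply: ler_sum => t _; case: ifP => // st.
rewrite indicE mem_set// => i; rewrite inE => ij.
have /eqP <- := agree_le depth_le ij st.
by apply: sw; rewrite inE.
Qed.

Hypothesis q_gt0 : forall i, 0 < q i.

(** The levels at which [s] and [t] agree form an initial segment, which is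
empty or of the form [upto j].  Compared with independent branches, this costs
a factor [1] or the inverse of [\prod_(i in upto j) q i]; summing over all [j]
at which they agree avoids referring to the last one. *)
Lemma prod_disagree_le (s t : N.-tuple bool) :
  \prod_(i | ~~ agree k s t i) q i <=
  (\prod_i q i) *
    (1 + \sum_j (agree k s t j)%:R * (\prod_(i in upto j) q i)^-1).
Proof.
have prodq (p : pred 'I_n) : 0 < \prod_(i | p i) q i by exact: prodr_gt0.
rewrite [X in _ <= X * _](bigID (agree k s t))/= -[leLHS]mul1r mulrAC.
rewrite ler_wpM2r ?(ltW (prodq _))// mulrC -ler_pdivrMr// div1r.
have term_ge0 j : 0 <= (agree k s t j)%:R * (\prod_(i in upto j) q i)^-1.
  by rewrite mulr_ge0// invr_ge0 ltW.
have [/existsP[i0 i0st]|/existsPn nst] := boolP [exists i, agree k s t i].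
  pose j := [arg max_(i > i0 | agree k s t i) (i : nat)].
  have [jst jmax] : agree k s t j /\ forall i, agree k s t i -> (i <= j)%N.
    by rewrite /j; case: arg_maxnP.
  rewrite [X in _ <= 1 + X](bigD1 j)//= jst mul1r (eq_bigl (mem (upto j))).
    by rewrite addrCA lerDl addr_ge0// sumr_ge0.
  move=> i; rewrite /= inE; apply/idP/idP; first exact: jmax.
  by move=> ij; exact: agree_le jst.
rewrite big_pred0 ?invr1 ?lerDl ?sumr_ge0// => i.
exact/negbTE.
Qed.

(** The relative variance of the number of hits is bounded by the sum over the
levels [j] of the inverse of the expected number of words meeting the
constraints up to level [j]. *)
Lemma prob_hits_lt :
  (P [set w | hits finset.setT w < (2 ^+ N * \prod_i q i) / 2]%R <=
    (4 * \sum_j (2 ^+ depth k N j * \prod_(i in upto j) q i)^-1)%R%:E)%E.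
Proof.
set Q := \prod_i q i; have Q0 : 0 < Q by exact: prodr_gt0.
have N0 : 0 < 2 ^+ N :> R by rewrite exprn_gt0.
pose V : R := (2 ^+ N * Q) ^+ 2 *
  (1 + \sum_j (2 ^+ depth k N j * \prod_(i in upto j) q i)^-1).
rewrite [X in (4 * X)%R](_ : _ = V / (2 ^+ N * Q) ^+ 2 - 1); last first.
  rewrite /V mulrAC divff ?mul1r 1?addrC ?addKr// gt_eqF//.
  by rewrite exprn_gt0// mulr_gt0.
apply: second_moment.
- by move=> s; exact: measurable_branch.
- exact: mulr_gt0.
- rewrite (eq_bigr (fun=> (\prod_(i in finset.setT) q i)%:E)); last first.
    by move=> s _; exact: prob_branch.
  rewrite sumEFin sumr_const card_tuple card_bool.
  rewrite -[_ *+ (2 ^ N)]mulr_natl natrX.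
  by congr (_ * _)%:E; apply: eq_bigl => i; rewrite inE.
have pairE (s t : N.-tuple bool) :
    P (branch_in finset.setT s `&` branch_in finset.setT t) =
    (Q * \prod_(i | ~~ agree k s t i) q i)%:E.
  rewrite (_ : _ `&` _ = branch_in finset.setT s `&`
      branch_in [set i | ~~ agree k s t i]%SET t); last first.
    apply/seteqP; split => w [sw tw]; split => // i _.
      by apply: tw; rewrite inE.
    have [/eqP <-|st] := boolP (agree k s t i); first by apply: sw; rewrite inE.
    by apply: tw; rewrite inE.
  rewrite prob_two_branches.
    by congr (_ * _)%:E; apply: eq_bigl => i; rewrite inE.
  by move=> i _; rewrite inE.
under eq_bigr do under eq_bigr do rewrite pairE.
under eq_bigr do rewrite sumEFin.
rewrite sumEFin lee_fin.
apply: (@le_trans _ _ (\sum_(s : N.-tuple bool) Q * (Q * (2 ^+ N *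
    (1 + \sum_j (2 ^+ depth k N j * \prod_(i in upto j) q i)^-1)))));
    last first.
  rewrite sumr_const card_tuple card_bool -[_ *+ (2 ^ N)]mulr_natl natrX /V.
  by rewrite le_eqVlt; apply/orP; left; apply/eqP; ring.
apply: ler_sum => s _; rewrite -mulr_sumr ler_pM2l//.
apply: le_trans (ler_sum _ (fun t _ => prod_disagree_le s t)) _.
rewrite -mulr_sumr ler_pM2l// big_split/= sumr_const card_tuple card_bool.
rewrite natrX mulrDr mulr1.
rewrite lerD2l exchange_big/= mulr_sumr; apply: ler_sum => j _.
rewrite -mulr_suml -natr_sum.
rewrite invfM mulrA ler_wpM2r ?invr_ge0 ?prodr_ge0//.
  by move=> i _; exact: ltW.
rewrite (_ : (\sum_i _)%N = #|[set t | agree k s t j]%SET|); last first.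
  rewrite -sum1dep_card [RHS]big_mkcond/=; apply: eq_bigr => t _.
  by case: (agree k s t j).
by rewrite (card_agree depth_le) natrX ler_pdivlMr ?exprn_gt0// -exprD subnK.
Qed.

End cascade.

(** * Almost sure estimates on one box *)

Section cascade_LDP.
Context {d} {T : measurableType d} {R : realType} (P : probability T R).
Variables (n : nat) (k : 'I_n -> nat -> nat).
Variable xi :
  forall (N : nat) (i : 'I_n), (depth k N i).-tuple bool -> {RV P >-> R}.
Arguments xi : clear implicits.

Lemma empirical_measure_box (B : 'I_n -> set R) N w :
  empirical_measure xi N w (box B) =
    ((2 ^+ N)^-1 * hits xi N B finset.setT w)%:E.
Proof.
rewrite /empirical_measure /hits /occurrences EFinM -sumEFin.
congr (_ * _)%E; apply: eq_bigr => s _; rewrite diracE indicE.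
congr (_%:R%:E); congr nat_of_bool; apply/idP/idP => /set_mem sw; apply/mem_set.
  by move=> i _; have := sw i; rewrite mxE.
by move=> i; rewrite mxE; apply: sw; rewrite inE.
Qed.

(** A sum of point masses is subadditive on arbitrary sets, measurable or not;
for a list of length one, this is monotonicity. *)
Lemma empirical_measure_cover (J : eqType) (L : seq J)
    (F : set 'rV[R]_n) (G : J -> set 'rV[R]_n) N w :
  (forall x, F x -> exists2 s, s \in L & G s x) ->
  (empirical_measure xi N w F <=
    \sum_(s <- L) empirical_measure xi N w (G s))%E.
Proof.
move=> FG; rewrite /empirical_measure -ge0_sume_distrr; last first.
  by move=> s _; apply: sume_ge0.
rewrite lee_wpmul2l// ?lee_fin ?invr_ge0 ?exprn_ge0//.
rewrite exchange_big/=; apply: lee_sum => t _; rewrite !diracE.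
case: (boolP (_ \in F)) => [/set_mem/FG[s sL Gs]|_]; last exact: sume_ge0.
by rewrite (big_rem s)//= diracE mem_set// leeDl// sume_ge0.
Qed.

Hypothesis sum_k : forall N : nat, (1 <= N)%N -> (\sum_(j < n) k j N)%N = N.
Variable lambda : 'I_n -> nat -> probability R R.
Hypothesis xi_law : forall (N : nat) (i : 'I_n) (s : (depth k N i).-tuple bool),
  (1 <= N)%N -> forall B : set R, measurable B ->
  distribution P (xi N i s) B = lambda i N B.
Hypothesis xi_indep : forall N : nat, (1 <= N)%N ->
  mutually_independent (node_rv xi (N := N)).
Variable p : 'I_n -> R.
Hypothesis k_lim : forall j,
  ((k j N)%:R / N%:R : R) @[N --> \oo] --> p j.

Lemma depth_le N : (1 <= N)%N -> forall j, (depth k N j <= N)%N.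
Proof.
move=> N1 j; rewrite -[X in (_ <= X)%N]sum_k//.
rewrite [X in (_ <= X)%N](bigID (fun i : 'I_n => (i <= j)%N))/=.
exact: leq_addr.
Qed.

Lemma depth_lim j :
  ((depth k N j)%:R / N%:R : R) @[N --> \oo] --> \sum_(i in upto j) p i.
Proof.
have -> : (fun N => (depth k N j)%:R / N%:R : R) =
    (fun N => \sum_(i in upto j) (k i N)%:R / N%:R).
  apply/funext => N; rewrite -mulr_suml natr_sum; congr (_ * _).
  by apply: eq_bigl => i; rewrite inE.
apply: cvg_big => [|i _]; [exact: add_continuous|exact: k_lim].
Qed.

Let exp2 m : 2 ^+ m = expR (ln 2 * m%:R) :> R.
Proof. by rewrite expRM_natr lnK// posrE. Qed.

Lemma pow_depth_le j (a : R) : (\sum_(i in upto j) p i) * ln 2 < a ->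
  \forall N \near \oo, (2 ^+ depth k N j <= expR (a * N%:R) :> R).
Proof.
rewrite -ltr_pdivlMr ?ln_gt0 ?ltr1n// => /(cvgr_lt _ (@depth_lim j)).
apply: filterS2 (nbhs_infty_gt 0) => N N0.
rewrite ltr_pdivrMr ?ltr0n// mulrAC ltr_pdivlMr ?ln_gt0 ?ltr1n// => /ltW.
by rewrite exp2 ler_expR mulrC.
Qed.

Lemma pow_depth_ge j (a : R) : a < (\sum_(i in upto j) p i) * ln 2 ->
  \forall N \near \oo, (expR (a * N%:R) <= 2 ^+ depth k N j :> R).
Proof.
rewrite -ltr_pdivrMr ?ln_gt0 ?ltr1n// => /(cvgr_gt _ (@depth_lim j)).
apply: filterS2 (nbhs_infty_gt 0) => N N0.
rewrite ltr_pdivlMr ?ltr0n// mulrAC ltr_pdivrMr ?ln_gt0 ?ltr1n// => /ltW.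
by rewrite exp2 ler_expR [leRHS]mulrC.
Qed.

Section one_box.
Variable B : 'I_n -> set R.
Hypothesis mB : forall i, measurable (B i).

Definition mass N i : R := fine (lambda i N (B i)).

Lemma mass_ge0 N i : 0 <= mass N i.
Proof. exact: fine_ge0. Qed.

Let massE N : (1 <= N)%N -> forall i (s : (depth k N i).-tuple bool),
  distribution P (xi N i s) (B i) = (mass N i)%:E.
Proof. by move=> N1 i s; rewrite xi_law// fineK// fin_num_measure. Qed.

Let measurable_hits_ge N S t : measurable [set w | t <= hits xi N B S w].
Proof. by apply: measurable_occurrences_ge => s; exact: measurable_branch. Qed.

Let measurable_hits_lt N S t : measurable [set w | hits xi N B S w < t].
Proof. by apply: measurable_occurrences_lt => s; exact: measurable_branch. Qed.

(** By [hits_gap], asking for at least [2 ^ (N - depth k N j)] hits up to level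
[j] amounts to asking for one, so the bound of Markov's inequality is the
expected number of words at level [j]. *)
Lemma box_empty j (c : R) : (\sum_(i in upto j) p i) * ln 2 < c ->
    (\forall N \near \oo,
       \prod_(i in upto j) mass N i <= expR (- c * N%:R)) ->
  {ae P, forall w, \forall N \near \oo, empirical_measure xi N w (box B) = 0%E}.
Proof.
move=> pc massc.
pose e := (c - (\sum_(i in upto j) p i) * ln 2) / 2.
have e0 : 0 < e by rewrite divr_gt0// subr_gt0.
pose A N := [set w | 2 ^+ (N - depth k N j) <= hits xi N B (upto j) w].
have : {ae P, forall w, \forall N \near \oo, ~ A N w}.
  apply: (@borel_cantelli_expR _ _ _ _ _ 1 e) => //.
    by move=> N; exact: measurable_hits_ge.
  have pe : (\sum_(i in upto j) p i) * ln 2 < c - e by rewrite /e; lra.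
  apply: filterS3 (nbhs_infty_gt 0) massc (pow_depth_le pe) => N N0 massc powN.
  apply: le_trans (prob_hits_ge mB (massE N0) (xi_indep N0) _ _) _.
    by rewrite exprn_gt0.
  have KN := depth_le N0 j.
  rewrite lee_fin mul1r -[X in _ * (2 ^+ X * _)](subnK KN) exprD -mulrA.
  rewrite mulKf ?expf_neq0 ?pnatr_eq0//.
  have -> : - e * N%:R = (c - e) * N%:R + - c * N%:R by ring.
  by rewrite expRD ler_pM// prodr_ge0// => i _; exact: mass_ge0.
apply: filterS => w; apply: filterS2 (nbhs_infty_gt 0) => N N0 /negP.
rewrite -ltNge => /(hits_gap (depth_le N0)) hits0.
rewrite empirical_measure_box; apply/eqP; rewrite eqe mulf_eq0.
apply/orP; right.
rewrite eq_le occurrences_ge0 andbT -hits0; apply: hits_subset.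
exact: finset.subsetT.
Qed.

Lemma box_upper (c c' : R) : c < c' ->
    (\forall N \near \oo, \prod_i mass N i <= expR (- c' * N%:R)) ->
  {ae P, forall w, \forall N \near \oo,
    (empirical_measure xi N w (box B) <= (expR (- c * N%:R))%:E)%E}.
Proof.
move=> cc' massc.
pose A N := [set w | 2 ^+ N * expR (- c * N%:R) <= hits xi N B finset.setT w].
have : {ae P, forall w, \forall N \near \oo, ~ A N w}.
  apply: (@borel_cantelli_expR _ _ _ _ _ 1 (c' - c)) => //.
  - by move=> N; exact: measurable_hits_ge.
  - by rewrite subr_gt0.
  apply: filterS2 (nbhs_infty_gt 0) massc => N N0 massc.
  apply: le_trans (prob_hits_ge mB (massE N0) (xi_indep N0) _ _) _.
    by rewrite mulr_gt0 ?exprn_gt0 ?expR_gt0.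
  rewrite lee_fin mul1r invfM mulrACA mulVf ?mul1r ?expf_neq0 ?pnatr_eq0//.
  have -> : - (c' - c) * N%:R = - (- c * N%:R) + - c' * N%:R by ring.
  rewrite expRD -expRN ler_wpM2l ?expR_ge0//.
  by rewrite (eq_bigl xpredT)// => i; rewrite inE.
apply: filterS => w; apply: filterS => N /negP.
rewrite -ltNge => /ltW hle; rewrite empirical_measure_box lee_fin.
by rewrite ler_pdivrMl ?exprn_gt0.
Qed.

(** The strict inequalities make the expected number of words exponentially
large at every level, hence the relative variance summable in [N]. *)
Lemma box_lower (c : 'I_n -> R) :
    (forall j, \sum_(i in upto j) c i < (\sum_(i in upto j) p i) * ln 2) ->
    (\forall N \near \oo, forall i, expR (- c i * N%:R) <= mass N i) ->
  {ae P, forall w, \forall N \near \oo,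
    (((\prod_i mass N i) / 2)%:E <= empirical_measure xi N w (box B))%E}.
Proof.
move=> cp massc.
pose A N :=
  [set w | hits xi N B finset.setT w < 2 ^+ N * (\prod_i mass N i) / 2].
have [e e0 ecp] : exists2 e : R, 0 < e &
    forall j, \sum_(i in upto j) c i + e < (\sum_(i in upto j) p i) * ln 2.
  near (0 : R)^'+ => e; exists e => //; near: e; apply: filter_forall => j.
  near=> e; rewrite -ltrBrDl; near: e.
  by apply: nbhs_right_lt; rewrite subr_gt0.
have : {ae P, forall w, \forall N \near \oo, ~ A N w}.
  apply: (@borel_cantelli_expR _ _ _ _ _ (4 * n%:R) e) => //.
    by move=> N; exact: measurable_hits_lt.
  have powN : \forall N \near \oo, forall j,
      expR ((\sum_(i in upto j) c i + e) * N%:R) <= 2 ^+ depth k N j :> R.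
    by apply: filter_forall => j; exact: pow_depth_ge.
  apply: filterS3 (nbhs_infty_gt 0) massc powN => N N0 massc powN.
  have mass_gt0 i : 0 < mass N i.
    by apply: lt_le_trans (massc i); exact: expR_gt0.
  apply: le_trans (prob_hits_lt (depth_le N0) mB (massE N0) (xi_indep N0)
    mass_gt0) _.
  rewrite lee_fin -mulrA ler_pM2l// mulr_natl.
  rewrite -[n in X in _ <= X]card_ord -sumr_const.
  apply: ler_sum => j _; rewrite mulNr expRN.
  rewrite lef_pV2 ?posrE ?expR_gt0//; last first.
    by rewrite mulr_gt0 ?exprn_gt0 ?prodr_gt0.
  have -> : e * N%:R = (\sum_(i in upto j) c i + e) * N%:R +
      \sum_(i in upto j) - c i * N%:R.
    by rewrite -mulr_suml sumrN; ring.
  rewrite expRD expR_sum ler_pM ?expR_ge0//.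
    by rewrite prodr_ge0// => i _; exact: expR_ge0.
  by apply: ler_prod => i _; rewrite expR_ge0 massc.
apply: filterS => w; apply: filterS => N /negP.
rewrite -leNgt => hge; rewrite empirical_measure_box lee_fin.
by rewrite ler_pdivlMl ?exprn_gt0// mulrA.
Unshelve. all: by end_near.
Qed.

End one_box.

Hypothesis p_gt0 : forall j, 0 < p j.
Variable I : 'I_n -> R -> \bar R.
Hypothesis I_LDP : forall j, LDP (lambda j) (I j).
Hypothesis I_good : forall j, good_rate (I j).
Hypothesis I_sqc : forall j, strictly_quasi_convex (I j : R^o -> \bar R).

Let I_ge0 j x : (0 <= I j x)%E.
Proof. by have [] := I_LDP j. Qed.

Let I_lsc j : lower_semicontinuous (I j).
Proof. by have [] := I_LDP j. Qed.

(** * Almost sure estimates on all rational boxes *)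

(** The two ways in which the mass of the box [B] can decay faster than
[exp (- c N)]: emptiness at some level, or smallness of the mean. *)
Definition decays (B : 'I_n -> set R) (c : R) : Prop :=
  (exists j a, (\sum_(i in upto j) p i) * ln 2 < a /\
     \forall N \near \oo,
       \prod_(i in upto j) mass B N i <= expR (- a * N%:R)) \/
  (exists2 a, c < a &
     \forall N \near \oo, \prod_i mass B N i <= expR (- a * N%:R)).

(** All the constraints are strict on [B], so that branches abound in it. *)
Definition charged (B : 'I_n -> set R) : Prop :=
  exists2 c : 'I_n -> R,
    (forall j, \sum_(i in upto j) c i < (\sum_(i in upto j) p i) * ln 2) &
    \forall N \near \oo, forall i, expR (- c i * N%:R) <= mass B N i.

(** Besides rational intervals, complements of rational intervals serve to
express that one coordinate is large; the complement of the empty interval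
leaves the other coordinates free. *)
Definition side (s : bool * (rat * rat)) : set R :=
  let: (b, (q, r)) := s in
  if b then [set` `[ratr q, ratr r]] else ~` [set` `](ratr q), (ratr r)[].

Definition sides (s : {ffun 'I_n -> bool * (rat * rat)}) (i : 'I_n) : set R :=
  side (s i).

Lemma closed_sides s i : closed (sides s i).
Proof.
rewrite /sides; case: (s i) => -[] [q r]; first exact: itv_closed.
by apply: open_closedC; exact: itv_open.
Qed.

Lemma measurable_sides s i : measurable (sides s i).
Proof. by apply: closed_measurable; exact: closed_sides. Qed.

Definition typical (w : T) : Prop := forall s,
  (forall c : rat, decays (sides s) (ratr c) -> \forall N \near \oo,
     (empirical_measure xi N w (box (sides s)) <=
       (expR (- ratr c * N%:R))%:E)%E) /\
  (charged (sides s) -> \forall N \near \oo,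
     (((\prod_i mass (sides s) N i) / 2)%:E <=
       empirical_measure xi N w (box (sides s)))%E).

Lemma ae_typical : {ae P, forall w, typical w}.
Proof.
apply: ae_countable => s; have ms := measurable_sides s.
have ae1 (c : rat) : {ae P, forall w, decays (sides s) (ratr c) ->
    \forall N \near \oo,
     (empirical_measure xi N w (box (sides s)) <=
       (expR (- ratr c * N%:R))%:E)%E}.
  have [dec|ndec] := pselect (decays (sides s) (ratr c)); last first.
    by apply: aeW.
  case: (dec) => [[j [a [pa mass_a]]]|[a ca mass_a]].
    have := box_empty ms pa mass_a.
    apply: filterS => w ew _; apply: filterS ew => N ->.
    by rewrite lee_fin expR_ge0.
  have := box_upper ms ca mass_a.
  by apply: filterS => w uw _.
have ae2 : {ae P, forall w, charged (sides s) -> \forall N \near \oo,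
     (((\prod_i mass (sides s) N i) / 2)%:E <=
       empirical_measure xi N w (box (sides s)))%E}.
  have [[c cp mass_c]|nch] := pselect (charged (sides s)); last exact: aeW.
  have := box_lower ms cp mass_c.
  by apply: filterS => w uw _.
by apply: filterS2 (ae_countable ae1) ae2 => w.
Qed.

(** * The large deviation principle for typical outcomes *)

Implicit Types B : 'I_n -> set R.

Lemma mass_le1 B N i : measurable (B i) -> mass B N i <= 1.
Proof.
by move=> mBi; rewrite -lee_fin /mass fineK ?fin_num_measure// probability_le1.
Qed.

Lemma mass_upper B i (c b : R) : closed (B i) ->
    (forall u, B i u -> (b%:E <= I i u)%E) -> c < b ->
  \forall N \near \oo, mass B N i <= expR (- c * N%:R).
Proof.
move=> clB bI /(LDP_upper (I_LDP i) clB bI); apply: filterS => N.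
by rewrite -lee_fin /mass fineK// fin_num_measure//; exact: closed_measurable.
Qed.

Lemma mass_lower B i u (c : R) : measurable (B i) -> (B i)° u ->
    (I i u < c%:E)%E ->
  \forall N \near \oo, expR (- c * N%:R) <= mass B N i.
Proof.
move=> mBi Bu /(LDP_lower (I_LDP i) (@open_interior _ _) Bu).
apply: filterS => N le; rewrite -lee_fin /mass fineK ?fin_num_measure//.
apply: le_trans le _; apply: le_measure; rewrite ?inE//.
  by apply: open_measurable; exact: open_interior.
exact: interior_subset.
Qed.

Lemma prod_mass_upper B (S : {set 'I_n}) (c : 'I_n -> R) :
    (forall i, \forall N \near \oo, mass B N i <= expR (- c i * N%:R)) ->
  \forall N \near \oo, \prod_(i in S) mass B N i <=
    expR (- (\sum_(i in S) c i) * N%:R).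
Proof.
move=> /filter_forall; apply: filterS => N cN.
rewrite -sumrN mulr_suml expR_sum; apply: ler_prod => i _.
by rewrite mass_ge0 cN.
Qed.

(** Lower semicontinuity keeps the rates of the coordinates bounded below on a
small box around [x], whether a constraint fails at [x] or the sum of the rates
is large there. *)
Lemma decays_nbhs (x : 'rV[R]_n) (c : R) : (c%:E < cascade_rate p I x)%E ->
  exists2 s, nbhs x (box (sides s)) & decays (sides s) c.
Proof.
have loc (S : {set 'I_n}) (a : R) : (a%:E < \sum_(i in S) I i (x ord0 i))%E ->
    exists2 s, nbhs x (box (sides s)) & exists2 b, a < b &
      \forall N \near \oo,
        \prod_(i in S) mass (sides s) N i <= expR (- b * N%:R).
  move=> /(sum_rate_nbhs I_ge0 I_lsc)[b ab bI].
  have /choice[f fP] i : exists qr : rat * rat,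
      ratr qr.1 < x ord0 i < ratr qr.2 /\ exists2 b', b i < b' &
        [set` `[ratr qr.1, ratr qr.2]] `<=` [set u | (b'%:E < I i u)%E].
    have [b' bb' /nbhs_rat_itv[qr [xqr qrI]]] := bI i.
    by exists qr; split => //; exists b'.
  pose s : {ffun 'I_n -> bool * (rat * rat)} := [ffun i => (true, f i)].
  have sE i : sides s i = [set` `[ratr (f i).1, ratr (f i).2]].
    by rewrite /sides /s ffunE; case: (f i).
  exists s.
    apply: nbhs_box => i; rewrite sE.
    have [xf _] := fP i; apply: filterS (near_in_itvoo _); last first.
      by rewrite in_itv/=; exact: xf.
    by apply: subset_itvW.
  exists (\sum_(i in S) b i) => //; apply: prod_mass_upper => i.
  have [_ [b' bb' fI]] := fP i.
  apply: (mass_upper (@closed_sides s i) _ bb') => u.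
  by rewrite sE => /fI/ltW.
case/cascade_rate_gt => [[j /loc[s xs [b jb sb]]]|/loc[s xs [b cb sb]]].
  by exists s => //; left; exists j, b.
exists s => //; right; exists b => //; apply: filterS sb => N.
by rewrite (eq_bigl xpredT)// => i; rewrite inE.
Qed.

Definition far i (m : rat) : {ffun 'I_n -> bool * (rat * rat)} :=
  [ffun l => (false, if l == i then (- m, m) else (0, 0))].

Lemma farP i (m : rat) (x : 'rV[R]_n) :
  ~~ (- ratr m < x ord0 i < ratr m) -> box (sides (far i m)) x.
Proof.
move=> xm l; rewrite /sides /far ffunE.
case: eqP => [->|_] /=; rewrite in_itv/=.
  by rewrite rmorphN; exact/negP.
by rewrite !rmorph0 => /andP[x0 /(lt_trans x0)]; rewrite ltxx.
Qed.

(** By goodness, the rate of a coordinate is uniformly large away from a compact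
set; there it exceeds the entropy of the words of its level, and no branch can
afford it. *)
Lemma decays_far i : exists m, forall c, decays (sides (far i m)) c.
Proof.
pose a := `|(\sum_(l in upto i) p l) * ln 2| + 1.
have a0 : 0 <= a + 1 by rewrite !addr_ge0.
have /(@compact_bounded _ R^o)/pinfty_ex_gt0[M M0 MI] := @I_good i _ a0.
have [m] : exists m : rat, ratr m \in `]M, (M + 1)[ by apply: rat_in_itvoo; lra.
rewrite in_itv/= => /andP[Mm _].
exists m => c; left; exists i, a; split.
  by rewrite /a ltr_pwDr// ler_norm.
have : \forall N \near \oo,
    mass (sides (far i m)) N i <= expR (- a * N%:R).
  apply: (mass_upper (b := a + 1) (@closed_sides _ i)); last by rewrite ltrDl.
  move=> u; rewrite /sides /far ffunE eqxx/= in_itv/= rmorphN => um.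
  rewrite leNgt; apply/negP => /ltW /MI/= uM; apply: um.
  by rewrite -ltr_norml (le_lt_trans uM).
apply: filterS => N; apply: le_trans.
rewrite (bigD1 i)/=; last by rewrite inE.
rewrite ler_piMr ?mass_ge0//; apply: prodr_ile1 => l _.
by rewrite mass_ge0 mass_le1//; exact: measurable_sides.
Qed.

Lemma near_seq (J : eqType) (L : seq J) (Q : J -> nat -> Prop) :
    (forall s, s \in L -> \forall N \near \oo, Q s N) ->
  \forall N \near \oo, forall s, s \in L -> Q s N.
Proof.
elim: L => [_|s L IH LQ]; first exact: nearW.
have QL : \forall N \near \oo, forall t, t \in L -> Q t N.
  by apply: IH => t tL; apply: LQ; rewrite inE tL orbT.
apply: filterS2 (LQ s (mem_head _ _)) QL => N Qs QL t.
by rewrite inE => /orP[/eqP->|/QL].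
Qed.

Lemma typical_upper w (F : set 'rV[R]_n) (c c' : R) : typical w -> closed F ->
    (forall x, F x -> (c%:E <= cascade_rate p I x)%E) -> c' < c ->
  \forall N \near \oo,
    (empirical_measure xi N w F <= (expR (- c' * N%:R))%:E)%E.
Proof.
move=> wtyp Fcl Fc /rat_in_itvoo[r]; rewrite in_itv/= => /andP[c'r rc].
have /choice[m mP] := decays_far.
pose K : set 'rV[R]_n :=
  [set x | forall i, `[- ratr (m i), ratr (m i)]%classic (x ord0 i)].
have Kco : compact K.
  apply: (@rV_compact R n (fun i => `[- ratr (m i), ratr (m i)]%classic)) => i.
  exact: segment_compact.
have : compact (K `&` F) by exact: compact_closedI.
rewrite compact_cover => /(_ _ [set s | decays (sides s) (ratr r)]
  (fun s => (box (sides s))°)).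
case=> [s _|x [_ Fx]|D' D'dec KF].
- exact: open_interior.
- have /decays_nbhs[s xs sdec] : ((ratr r)%:E < cascade_rate p I x)%E.
    by apply: lt_le_trans (Fc _ Fx); rewrite lte_fin.
  by exists s.
(* the finite cover of the compact part, and the [n] boxes at infinity *)
pose L : seq {ffun 'I_n -> bool * (rat * rat)} :=
  finmap.enum_fset D' ++ [seq far i (m i) | i <- enum 'I_n].
have Ldec s : s \in L -> decays (sides s) (ratr r).
  rewrite mem_cat => /orP[/D'dec|/mapP[i _ ->]]; last exact: mP.
  by rewrite inE.
have FL x : F x -> exists2 s, s \in L & box (sides s) x.
  move=> Fx; have [xK|xK] := pselect (K x).
    have [s sD' /interior_subset xs] := KF x (conj xK Fx).
    by exists s => //; rewrite mem_cat sD'.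
  have [i xiK] : exists i, ~ (`[- ratr (m i), ratr (m i)]%classic (x ord0 i)).
    by apply/existsNP.
  exists (far i (m i)).
    rewrite mem_cat; apply/orP; right; apply/mapP.
    by exists i; rewrite ?mem_enum.
  apply: farP; apply/negP => /andP[x1 x2]; apply: xiK; rewrite /= in_itv/=.
  by rewrite !ltW.
have /near_seq : forall s, s \in L -> \forall N \near \oo,
   (empirical_measure xi N w (box (sides s)) <= (expR (- ratr r * N%:R))%:E)%E.
  by move=> s /Ldec; exact: (wtyp s).1.
apply: filterS2 (expR_absorb (size L)%:R c'r) => N absorb Lle.
apply: le_trans
  (empirical_measure_cover (G := fun s => box (sides s)) N w FL) _.
apply: (@le_trans _ _ ((size L)%:R * expR (- ratr r * N%:R))%:E);
  last by rewrite lee_fin.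
rewrite big_seq; apply: le_trans (lee_sum _ Lle) _.
by rewrite -big_seq sumEFin big_const_seq count_predT iter_addr_0 mulr_natl.
Qed.

Lemma typical_lower w (U : set 'rV[R]_n) x (c : R) :
    typical w -> open U -> U x -> (cascade_rate p I x < c%:E)%E ->
  \forall N \near \oo, ((expR (- c * N%:R))%:E <= empirical_measure xi N w U)%E.
Proof.
move=> wtyp Uop Ux Jc.
have xD : admissible p I x.
  apply: contrapT => /cascade_rate_infty Joo.
  by move: Jc; rewrite Joo ltNge leey.
move: Jc; rewrite cascade_rateE// => Jc.
have [B xB BU] := nbhs_boxP (open_nbhs_nbhs (conj Uop Ux)).
have /choice[f fP] i : exists qr : rat * rat,
      ratr qr.1 < x ord0 i < ratr qr.2 /\
        [set` `[ratr qr.1, ratr qr.2]] `<=` B i.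
  by have /nbhs_rat_itv := xB i.
pose s : {ffun 'I_n -> bool * (rat * rat)} := [ffun i => (true, f i)].
have sE i : sides s i = [set` `[ratr (f i).1, ratr (f i).2]].
  by rewrite /sides /s ffunE; case: (f i).
have sU : box (sides s) `<=` U.
  apply: subset_trans BU => y sy i; have [_] := fP i; apply.
  by rewrite -sE; exact: sy.
have Ifin i : (I i (x ord0 i) < +oo)%E.
  apply: le_lt_trans (lt_trans Jc (ltry _)).
  by rewrite (bigD1 i)//= leeDl// sume_ge0.
have /choice[y yP] i : exists y,
    [/\ (sides s i)° y, (I i y <= I i (x ord0 i))%E &
    (0 < I i (x ord0 i))%E -> (I i y < I i (x ord0 i))%E].
  apply: (rate_decrease (I_LDP i) (I_sqc i)) => //.
  apply: nbhs_interior; rewrite sE; have [xf _] := fP i.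
  apply: filterS (near_in_itvoo _); last by rewrite in_itv/=; exact: xf.
  by apply: subset_itvW.
pose r i := fine (I i (x ord0 i)); pose a i := fine (I i (y i)).
have rE i : I i (x ord0 i) = (r i)%:E by rewrite fineK// ge0_fin_numE.
have aE i : I i (y i) = (a i)%:E.
  have [_ yx _] := yP i; rewrite fineK// ge0_fin_numE//.
  exact: le_lt_trans yx _.
have ar i : a i <= r i by rewrite -lee_fin -rE -aE; have [] := yP i.
have ltar i : 0 < r i -> a i < r i.
  by rewrite -!lte_fin -rE -aE; have [] := yP i.
(* if all coordinates up to [j] have rate zero, strictness comes from [p > 0] *)
have ap j : \sum_(i in upto j) a i < (\sum_(i in upto j) p i) * ln 2.
  have : \sum_(i in upto j) r i <= (\sum_(i in upto j) p i) * ln 2.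
    rewrite -lee_fin -sumEFin; have /admissibleP/(_ j) := xD; apply: le_trans.
    by apply: lee_sum => i _; rewrite rE.
  have [/existsP[i /andP[ij ri]]|/existsPn r0] :=
      boolP [exists i, (i \in upto j) && (0 < r i)].
    apply: lt_le_trans; rewrite (bigD1 i)//= [ltRHS](bigD1 i)//=.
    by rewrite ltr_leD ?ltar// ler_sum.
  move=> _; apply: (@le_lt_trans _ _ 0).
    apply: sumr_le0 => i ij; apply: le_trans (ar i) _.
    by rewrite leNgt; apply: contra (r0 i) => ->; rewrite ij.
  rewrite mulr_gt0// ?ln_gt0 ?ltr1n// (bigD1 j)/=; last by rewrite inE.
  by rewrite ltr_pwDl// sumr_ge0// => i _; exact: ltW.
have ac : \sum_(i in finset.setT) a i < c.
  rewrite -lte_fin; apply: le_lt_trans Jc; rewrite -sumEFin.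
  rewrite (eq_bigl xpredT) => [|i]; last by rewrite inE.
  by apply: lee_sum => i _; rewrite rE lee_fin.
(* room to replace the rates [a i] by slightly larger numbers, as demanded by
   the lower bounds for the laws *)
have slack (S : {set 'I_n}) (b : R) : \sum_(i in S) a i < b ->
    \forall e \near 0^'+, \sum_(i in S) (a i + e) < b.
  move=> ab; near=> e; rewrite big_split/= sumr_const -ltrBrDl.
  apply: (@le_lt_trans _ _ (e * (#|S|%:R + 1))).
    by rewrite mulrDr mulr1 mulr_natr lerDl.
  rewrite -ltr_pdivlMr ?ltr_wpDl//; near: e; apply: nbhs_right_lt.
  by rewrite divr_gt0 ?subr_gt0 ?ltr_wpDl.
have [e [e0 ep ec]] : exists e, [/\ 0 < e,
    forall j, \sum_(i in upto j) (a i + e) < (\sum_(i in upto j) p i) * ln 2 &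
    \sum_(i in finset.setT) (a i + e) < c].
  near (0 : R)^'+ => e; exists e; split => //.
    by near: e; apply: filter_forall => j; exact: slack.
  by near: e; exact: slack.
have mass_e : \forall N \near \oo, forall i,
    expR (- (a i + e) * N%:R) <= mass (sides s) N i.
  apply: filter_forall => i; apply: (@mass_lower _ _ (y i)).
  - exact: measurable_sides.
  - by have [] := yP i.
  - by rewrite aE lte_fin ltrDl.
have charged_s : charged (sides s) by exists (fun i => a i + e).
have := (wtyp s).2 charged_s.
apply: filterS3 (expR_absorb 2 ec) mass_e => N absorb mass_e low.
have mono : (empirical_measure xi N w (box (sides s)) <=
    empirical_measure xi N w U)%E.
  have := @empirical_measure_cover _ [:: tt] (box (sides s)) (fun=> U) N w.
  by rewrite big_seq1; apply => z /sU; exists tt.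
apply: le_trans mono; apply: le_trans low.
rewrite lee_fin ler_pdivlMr// mulrC; apply: le_trans absorb _.
rewrite -sumrN mulr_suml expR_sum (eq_bigl xpredT) => [|i]; last by rewrite inE.
by apply: ler_prod => i _; rewrite expR_ge0 mass_e.
Unshelve. all: by end_near.
Qed.

Lemma typical_LDP w : typical w ->
  LDP (fun N => empirical_measure xi N w) (cascade_rate p I).
Proof.
move=> wtyp; apply: LDP_intro.
- exact: cascade_rate_ge0.
- exact: cascade_rate_lsc.
- move=> N A B AB; have := @empirical_measure_cover _ [:: tt] A (fun=> B) N w.
  by rewrite big_seq1; apply => z /AB; exists tt.
- by move=> F c c'; exact: typical_upper.
- by move=> U x c; exact: typical_lower.
Qed.

End cascade_LDP.

(** * Large deviations of the empirical measures *)

Theorem theorem0p2p3 (R : realType) (n : nat) (n_ge1 : (1 <= n)%N)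
    (lambda : 'I_n -> nat -> probability R R)
    (I : 'I_n -> R -> \bar R)
    (I_LDP : forall j, LDP (lambda j) (I j))
    (I_good : forall j, good_rate (I j))
    (I_sqc : forall j, strictly_quasi_convex (I j : R^o -> \bar R))
    (k : 'I_n -> nat -> nat)
    (sum_k : forall N : nat, (1 <= N)%N -> (\sum_(j < n) k j N)%N = N)
    (d : measure_display) (T : measurableType d) (P : probability T R)
    (xi : forall (N : nat) (i : 'I_n),
        (depth k N i).-tuple bool -> {RV P >-> R})
    (xi_law : forall (N : nat) (i : 'I_n) (s : (depth k N i).-tuple bool),
        (1 <= N)%N -> forall B : set R, measurable B ->
        distribution P (xi N i s) B = lambda i N B)
    (xi_indep : forall N : nat, (1 <= N)%N ->
        mutually_independent (node_rv xi (N := N)))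
    (p : 'I_n -> R) (p_gt0 : forall j, 0 < p j)
    (k_lim : forall j, ((k j N)%:R / N%:R : R) @[N --> \oo] --> p j) :
  {ae P, forall w : T,
    LDP (fun N : nat => empirical_measure xi N w) (cascade_rate p I)}.
Proof.
apply: filterS (ae_typical sum_k xi_law xi_indep k_lim) => w.
exact: typical_LDP.
Qed.
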